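(* A Banach space $X$ contains an isomorphic copy of $c_0$ if and only if $X$ admits an equivalent norm for which it is $(1,<1)$-$\mathrm{SQ}_{<\aleph_0}$.
   Context: For $s\in(0,1]$, a Banach space $Z$ is $(1,s)$-$\mathrm{SQ}_{<\aleph_0}$ if for every finite set $A\subset S_Z$ there exists $y\in S_Z$ with $\|x\pm sy\|\le 1$ for all $x\in A$. $Z$ is $(1,<1)$-$\mathrm{SQ}_{<\aleph_0}$ if it is $(1,s)$-$\mathrm{SQ}_{<\aleph_0}$ for every $s\in(0,1)$. *)

(* Defs.v *)
From HB Require Import structures.
From mathcomp Require Import all_boot all_order all_algebra.
From mathcomp Require Import all_classical all_reals all_analysis.
Set Implicit Arguments. Unset Strict Implicit. Unset Printing Implicit Defensive.
Import Order.TTheory GRing.Theory Num.Theory.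
Import numFieldNormedType.Exports.
Local Open Scope classical_set_scope.
Local Open Scope ring_scope.

Definition in_c0 {R : realType} (u : nat -> R) : Prop :=
  u n @[n --> \oo] --> (0 : R).

Definition supnorm {R : realType} (u : nat -> R) : R :=
  sup (range (fun n => `|u n|)).

Definition contains_c0 {R : realType} (X : normedModType R) : Prop :=
  exists T : (nat -> R) -> X,
    (forall (k : R) (u v : nat -> R), in_c0 u -> in_c0 v ->
        T (k *: u + v) = k *: T u + T v) /\
    exists a b : R, 0 < a /\ 0 < b /\
      forall u, in_c0 u -> a * supnorm u <= `|T u| /\ `|T u| <= b * supnorm u.

Definition is_norm {R : realType} (X : lmodType R) (N : X -> R) : Prop :=
  (forall x, 0 <= N x) /\
  (forall x, N x = 0 -> x = 0) /\
  (forall (k : R) x, N (k *: x) = `|k| * N x) /\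
  (forall x y, N (x + y) <= N x + N y).

Definition equiv_norm {R : realType} (X : normedModType R) (N : X -> R) : Prop :=
  is_norm N /\ exists c C : R, 0 < c /\ 0 < C /\
    forall x, c * `|x| <= N x /\ N x <= C * `|x|.

Definition SQ1_fin {R : realType} (X : lmodType R) (N : X -> R) (s : R) : Prop :=
  forall A : seq X, (forall x, x \in A -> N x = 1) ->
    exists y : X, N y = 1 /\
      forall x, x \in A -> N (x + s *: y) <= 1 /\ N (x - s *: y) <= 1.

Definition SQ1_lt1_fin {R : realType} (X : lmodType R) (N : X -> R) : Prop :=
  forall s : R, 0 < s -> s < 1 -> SQ1_fin N s.

(* Main.v *)
Require Import Defs.
From HB Require Import structures.
From mathcomp Require Import all_boot all_order all_algebra.
From mathcomp Require Import all_classical all_reals all_analysis.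
From mathcomp Require Import ring lra.
Import Order.TTheory GRing.Theory Num.Theory.
Import numFieldNormedType.Exports.
Local Open Scope classical_set_scope.
Local Open Scope ring_scope.

(* If [T : c0 -> X] is an embedding, extend its coordinate functionals to [f n]
   on [X] by Hahn-Banach and subtract from them their pointwise limit along a free
   ultrafilter, giving [g n]. Then [N x = max (sup_n |g n x|) (dist (x, T c0))] is
   an equivalent norm, and for each finite set [A] there are [n] with [g n] as
   small as desired on [A], so that adding [s *: T e_n] to an element of [A] does
   not increase [N] beyond 1.

   Conversely, for [s > 1/2] one picks inductively [y n] such that all sums
   [\sum_(i < n) +/- s *: y i] lie in the unit ball. By convexity
   [N (\sum_i u i *: y i) <= |u|_oo / s], and reflecting one coordinate yields
   the lower bound [(2 - 1 / s) |u|_oo], so the [y n] span a copy of [c0]. *)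

(** * Sublinear functionals and the Hahn-Banach theorem *)

Definition sublinear {R : realType} {V : lmodType R} (p : V -> R) : Prop :=
  (forall x y, p (x + y) <= p x + p y) /\
  (forall t x, 0 <= t -> p (t *: x) <= t * p x).

Definition linear_on_space {R : realType} {V : lmodType R} (f : V -> R) : Prop :=
  forall k x y, f (k *: x + y) = k * f x + f y.

Lemma sublinear_ge {R : realType} {V : lmodType R} (p : V -> R) (x : V) :
  sublinear p -> - p (- x) <= p x.
Proof.
move=> [pD _]; have := pD 0 0; rewrite addr0 => p0.
have := pD x (- x); rewrite subrr; lra.
Qed.

Lemma sublinearZ {R : realType} {V : lmodType R} (p : V -> R) (t : R) (x : V) :
  sublinear p -> 0 <= t -> p (t *: x) = t * p x.
Proof.
move=> sp t0; have [pD pZ] := sp; apply/eqP; rewrite eq_le pZ//=.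
have [->|tn0] := eqVneq t 0.
  have := pD 0 0; rewrite mul0r scale0r addr0; lra.
have := pZ t^-1 (t *: x); rewrite invr_ge0 t0 scalerA mulVf// scale1r.
by move=> /(_ isT); rewrite ler_pdivlMl// lt_neqAle eq_sym tn0.
Qed.

(** Common source of four infima: the perturbation of a minimal functional, the lower bound of a
    chain, the Hahn-Banach majorant, and the distance to the copy of [c0]. The two indices are
    varied one after the other, so one index [k] below each pair is enough. *)
Lemma sublinear_inf {R : realType} {V : lmodType R} {I : Type} (D : set I)
    (F : I -> V -> R) :
    D !=set0 ->
    (forall x, has_lbound [set F i x | i in D]) ->
    (forall i j x y, D i -> D j ->
      exists2 k, D k & F k (x + y) <= F i x + F j y) ->
    (forall i t x, D i -> 0 <= t -> exists2 k, D k & F k (t *: x) <= t * F i x) ->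
  sublinear (fun x => inf [set F i x | i in D]).
Proof.
move=> [i0 Di0] lbF FD FZ.
have infP i x : D i -> inf [set F i x | i in D] <= F i x.
  by move=> Di; apply: ge_inf => //; exists i.
have le_infP c x : (forall i, D i -> c <= F i x) -> c <= inf [set F i x | i in D].
  move=> cF; apply: lb_le_inf; first by exists (F i0 x); exists i0.
  by move=> _ [i Di <-]; exact: cF.
split=> [x y|t x t0].
  rewrite -lerBlDl; apply/le_infP => j Dj; rewrite lerBlDl -lerBlDr.
  apply/le_infP => i Di; rewrite lerBlDr.
  have [k Dk le_k] := FD i j x y Di Dj.
  exact: le_trans (infP k _ Dk) le_k.
have [t_eq0|tn0] := eqVneq t 0.
  have [k Dk] := FZ i0 t x Di0 t0; rewrite t_eq0 !mul0r.
  exact: le_trans (infP k _ Dk).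
have tgt0 : 0 < t by rewrite lt_neqAle eq_sym tn0.
rewrite -ler_pdivrMl//; apply/le_infP => i Di.
rewrite ler_pdivrMl//.
have [k Dk le_k] := FZ i t x Di t0.
exact: le_trans (infP k _ Dk) le_k.
Qed.

(** For fixed [y], the infimum over [t >= 0] of [q (z + t *: y) - t * q y] is sublinear in [z] and
    at most [q z] (take [t = 0]). By minimality it equals [q], and [t = 1] then gives
    [q x + q y <= q (x + y)]. *)
Lemma minimal_sublinear_linear {R : realType} {V : lmodType R} (q : V -> R) :
    sublinear q ->
    (forall r, sublinear r -> (forall x, r x <= q x) -> forall x, q x <= r x) ->
  linear_on_space q.
Proof.
move=> sq minq; have [qD qZ] := sq.
have qDE x y : q (x + y) = q x + q y.
  apply/eqP; rewrite eq_le qD /=.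
  pose F t z := q (z + t *: y) - t * q y.
  pose D := [set t : R | 0 <= t].
  have lbF z : has_lbound [set F t z | t in D].
    exists (- q (- z)) => _ [t t0 <-]; rewrite /F.
    have := qD (- z) (z + t *: y); rewrite addrA addNr add0r (sublinearZ q)//.
    lra.
  have sF : sublinear (fun z => inf [set F t z | t in D]).
    apply: sublinear_inf => //.
    - by exists 0; rewrite /D /=.
    - move=> s t z w s0 t0; exists (s + t); first exact: addr_ge0.
      have := qD (z + s *: y) (w + t *: y).
      by rewrite /F addrACA -scalerDl; lra.
    - move=> s t z s0 t0; exists (t * s); first exact: mulr_ge0.
      by rewrite /F -scalerA -scalerDr (sublinearZ q)// mulrBr mulrA.
  have leF z t : D t -> inf [set F t z | t in D] <= F t z.
    by move=> Dt; apply: ge_inf => //; exists t.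
  have Fq z : inf [set F t z | t in D] <= q z.
    have := leF z 0; rewrite /F scale0r addr0 mul0r subr0; apply.
    by rewrite /D /=.
  have := minq _ sF Fq x; have := leF x 1.
  rewrite /F scale1r mul1r => /(_ ler01); lra.
have q0 : q 0 = 0 by have := qDE 0 0; rewrite addr0; lra.
have qN x : q (- x) = - q x by have := qDE x (- x); rewrite subrr q0; lra.
move=> k x y; rewrite qDE; congr (_ + _).
have [k0|k0] := leP 0 k; first by rewrite (sublinearZ q).
by rewrite -[k]opprK scaleNr qN (sublinearZ q) ?mulNr// oppr_ge0 ltW.
Qed.

Lemma sublinear_dominates_linear {R : realType} {V : lmodType R} (p : V -> R) :
  sublinear p -> exists f : V -> R, linear_on_space f /\ forall x, f x <= p x.
Proof.
move=> sp.
pose P (q : V -> R) := sublinear q /\ forall x, q x <= p x.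
pose T := {q : V -> R | P q}.
(* The pointwise order is reversed, so that a maximal element from Zorn's lemma is a minimal
   sublinear functional. Chains are bounded by their pointwise infimum, finite because each member
   is at least [- p (- x)] at [x]. *)
pose le (q r : T) := `[< forall x, sval r x <= sval q x >].
have p0 : T by exists p.
have [|||[q [sq qp]] maxq] := @ZL_preorder T p0 le.
- by move=> t; apply/asboolP.
- move=> r s t /asboolP rs /asboolP st; apply/asboolP => x.
  exact: le_trans (st x) (rs x).
- move=> A totA.
  have [[q0 Aq0]|A0] := pselect (A !=set0); last first.
    by exists p0 => s As; exfalso; apply: A0; exists s.
  pose F (q : T) := sval q.
  have lbF x : has_lbound [set F q x | q in A].
    exists (- p (- x)) => _ [[q [sq qp]] _ <-] /=.
    by have := qp (- x); have := sublinear_ge q x sq; lra.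
  have leF x q : A q -> inf [set F q x | q in A] <= F q x.
    by move=> Aq; apply: ge_inf => //; exists q.
  have sF : sublinear (fun x => inf [set F q x | q in A]).
    apply: sublinear_inf => //; first by exists q0.
    - move=> q r x y Aq Ar; have [/asboolP qr|/asboolP rq] := totA q r Aq Ar.
        exists r => //; have [[rD _] _] := svalP r.
        by apply: le_trans (rD x y) _; rewrite lerD2r; exact: qr.
      exists q => //; have [[qD _] _] := svalP q.
      by apply: le_trans (qD x y) _; rewrite lerD2l; exact: rq.
    - move=> q t x Aq t0; exists q => //.
      by have [[_ qZ] _] := svalP q; exact: qZ.
  have Fp x : inf [set F q x | q in A] <= p x.
    by apply: le_trans (leF x _ Aq0) _; have [_ ] := svalP q0; exact.
  exists (exist P _ (conj sF Fp)) => s As; apply/asboolP => x /=.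
  exact: leF.
exists q; split => //; apply: minimal_sublinear_linear => // r sr rq.
have rp x : r x <= p x by exact: le_trans (rq x) (qp x).
have /asboolP := maxq (exist P r (conj sr rp)) (introT (asboolP _) rq).
exact.
Qed.

(* The partial functional is given by its graph [G], so that a functional
   defined on the range of an embedding needs no choice of preimages. *)
Lemma hahn_banach {R : realType} {V : lmodType R} (p : V -> R) (G : set (V * R)) :
    sublinear p -> G (0, 0) ->
    (forall k g h, G g -> G h -> G (k *: g.1 + h.1, k * g.2 + h.2)) ->
    (forall g, G g -> g.2 <= p g.1) ->
  exists f : V -> R, [/\ linear_on_space f, forall x, f x <= p x &
    forall g, G g -> f g.1 = g.2].
Proof.
move=> sp G0 GL Gp; have [pD pZ] := sp.
have GN g : G g -> G (- g.1, - g.2).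
  by move=> /(GL (-1) _ _)/(_ G0); rewrite scaleN1r mulN1r !addr0.
(* A linear [f] below the infimum of these is below [p], by [g = (0, 0)], and below [g.2] at [g.1].
   Passing to the opposite of [g] turns the latter into an equality. *)
pose F (g : V * R) x := p (x - g.1) + g.2.
have lbF x : has_lbound [set F g x | g in G].
  exists (- p (- x)) => _ [g Gg <-]; rewrite /F.
  have := Gp _ (GN _ Gg) => /=; have := pD (x - g.1) (- x).
  by rewrite addrAC subrr add0r; lra.
have leF x g : G g -> inf [set F g x | g in G] <= F g x.
  by move=> Gg; apply: ge_inf => //; exists g.
have sF : sublinear (fun x => inf [set F g x | g in G]).
  apply: sublinear_inf => //; first by exists (0, 0).
  - move=> g h x y Gg Gh; exists (g.1 + h.1, g.2 + h.2).
      by have := GL 1 _ _ Gg Gh; rewrite scale1r mul1r.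
    have := pD (x - g.1) (y - h.1).
    by rewrite /F/= addrACA -opprD; lra.
  - move=> g t x Gg t0; exists (t *: g.1, t * g.2).
      by have := GL t _ _ Gg G0; rewrite !addr0.
    by rewrite /F/= -scalerBr mulrDr lerD2r; exact: pZ.
have [f [lf fF]] := sublinear_dominates_linear _ sF.
have pp0 : p 0 = 0 by have := sublinearZ p 0 0 sp (lexx _); rewrite scale0r mul0r.
have fG g : G g -> f g.1 <= g.2.
  move=> Gg; apply: le_trans (fF _) _; apply: le_trans (leF _ _ Gg) _.
  by rewrite /F subrr pp0 add0r.
exists f; split=> //.
  move=> x; apply: le_trans (fF x) _; apply: le_trans (leF _ _ G0) _.
  by rewrite /F/= subr0 addr0.
move=> g Gg; apply/eqP; rewrite eq_le fG//=.
have f0 : f 0 = 0 by have := lf 1 0 0; rewrite scaler0 addr0; lra.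
have fN : f (- g.1) = - f g.1.
  by have := lf (-1) g.1 0; rewrite scaleN1r addr0 f0; lra.
by have := fG _ (GN _ Gg); rewrite /= fN; lra.
Qed.

(** * Limits along a free ultrafilter *)

(** Compactness of [[- M, M]] gives a cluster point, and an ultrafilter converges to each of its
    cluster points. *)
Lemma bounded_cvg_ultra {R : realType} (U : set_system nat) (u : nat -> R) (M : R) :
  UltraFilter U -> (forall n, `|u n| <= M) -> cvg (u n @[n --> U]).
Proof.
move=> UU uM; have PU : ProperFilter U by exact: ultra_proper.
have UM : (u n @[n --> U]) `[- M, M]%classic.
  by apply: (@filterE _ U) => n /=; rewrite in_itv/= -ler_norml; exact: uM.
have [l [_ ul]] := @segment_compact R (- M) M (u n @[n --> U]) _ UM.
apply/cvg_ex; exists l => B lB.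
have [//|UB] := in_ultra_setVsetC (u @^-1` B) UU.
by have [x [nBx /nBx]] := ul (~` B) B UB lB.
Qed.

(** [L] is the pointwise limit along an ultrafilter finer than [\oo]. For finite [A] the indices
    that are good at every point of [A] form a member of the ultrafilter, hence a nonempty set. *)
Lemma ultra_near0 {R : realType} {X : normedModType R} (f : nat -> X -> R) (K : R) :
    (forall n, linear_on_space (f n)) -> (forall n x, `|f n x| <= K * `|x|) ->
  exists L : X -> R, [/\ linear_on_space L, forall x, `|L x| <= K * `|x|,
    forall x, f n x @[n --> \oo] --> (0 : R) -> L x = 0 &
    forall (A : seq X) (e : R), 0 < e ->
      exists n, forall x, x \in A -> `|f n x - L x| <= e].
Proof.
move=> lf fK.
have [U [UU oU]] := @ultraFilterLemma nat \oo _.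
have PU : ProperFilter U by exact: ultra_proper.
have cf x : cvg (f n x @[n --> U]) by exact: bounded_cvg_ultra (fK^~ x).
exists (fun x => lim (f n x @[n --> U])); split.
- move=> k x y; apply/cvg_lim => //; under eq_fun do rewrite lf.
  apply: cvgD; last exact: cf.
  by apply: cvgM; [exact: cvg_cst|exact: cf].
- move=> x; have h : `|f n x| @[n --> U] --> `|lim (f n x @[n --> U])| by exact: cvg_norm (cf x).
  rewrite -(cvg_lim _ h)//; apply: limr_le; first by apply/cvg_ex; eexists; exact: h.
  by apply: filterS filterT => n _; exact: fK.
- move=> x f0; apply/cvg_lim => //.
  exact: cvg_trans (cvg_app _ oU) f0.
- move=> A e e0.
  suff : U [set n | forall x, x \in A -> `|f n x - lim (f n x @[n --> U])| <= e].
    by move=> /filter_ex[n]; exists n.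
  elim: A => [|z A IH]; first by apply: filterS filterT => n _ x.
  have /cvgrPdist_le/(_ _ e0) := cf z.
  move: IH; apply: filterS2 => n IH hz x; rewrite inE => /orP[/eqP ->|/IH//].
  by rewrite distrC.
Qed.

(** * The space [c0] and coordinate functionals on an embedded copy *)

Lemma in_c0_lin {R : realType} (k : R) (u v : nat -> R) :
  in_c0 u -> in_c0 v -> in_c0 (k *: u + v).
Proof.
move=> u0 v0; rewrite /in_c0 -[X in _ --> X]addr0 -[X in _ --> X + _](mulr0 k).
by apply: cvgD; [apply: cvgM; [exact: cvg_cst|exact: u0]|exact: v0].
Qed.

Lemma in_c00 {R : realType} : in_c0 (0 : nat -> R).
Proof. exact: cvg_cst. Qed.

Lemma le_supnorm {R : realType} (u : nat -> R) (M : R) (n : nat) :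
  (forall m, `|u m| <= M) -> `|u n| <= supnorm u.
Proof. by move=> uM; apply: ub_le_sup; [exists M => _ [m _ <-]|exists n]. Qed.

Lemma supnorm_le {R : realType} (u : nat -> R) (M : R) :
  (forall m, `|u m| <= M) -> supnorm u <= M.
Proof.
by move=> uM; apply: ge_sup; [exists `|u 0%N|; exists 0%N|move=> _ [m _ <-]].
Qed.

Lemma in_c0_le_supnorm {R : realType} (u : nat -> R) (n : nat) :
  in_c0 u -> `|u n| <= supnorm u.
Proof.
move=> u0; have [M [_ Mu]] : bounded_fun u by apply/cvg_seq_bounded/cvg_ex; exists 0.
by apply: (@le_supnorm _ _ (M + 1)) => m; apply: Mu; rewrite ?ltrDl.
Qed.

Lemma linear_on_spaceZ {R : realType} {V : lmodType R} (f : V -> R) (k : R) (x : V) :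
  linear_on_space f -> f (k *: x) = k * f x.
Proof.
move=> lf; have f0 := lf 1 0 0; rewrite scaler0 addr0 in f0.
have := lf k x 0; rewrite addr0; lra.
Qed.

Lemma linear_on_spaceD {R : realType} {V : lmodType R} (f : V -> R) (x y : V) :
  linear_on_space f -> f (x + y) = f x + f y.
Proof. by move=> lf; rewrite -[x in LHS]scale1r lf mul1r. Qed.

Definition linear_on_c0 {R : realType} {X : lmodType R} (T : (nat -> R) -> X) : Prop :=
  forall (k : R) (u v : nat -> R), in_c0 u -> in_c0 v ->
    T (k *: u + v) = k *: T u + T v.

Lemma linear_on_c00 {R : realType} {X : lmodType R} (T : (nat -> R) -> X) :
  linear_on_c0 T -> T 0 = 0.
Proof.
move=> TL; have := TL 1 _ _ in_c00 in_c00; rewrite scaler0 scale1r addr0 => h.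
by apply: (addrI (T 0)); rewrite -h addr0.
Qed.

(** Hahn-Banach applies to the graph of [T u |-> u n]: the lower bound on [T] gives
    [u n <= supnorm u], which is at most [a^-1] times the norm of [T u]. *)
Lemma coordinate_functionals {R : realType} {X : normedModType R}
    (T : (nat -> R) -> X) (a : R) :
    linear_on_c0 T ->
    0 < a -> (forall u, in_c0 u -> a * supnorm u <= `|T u|) ->
  exists f : nat -> X -> R, [/\ forall n, linear_on_space (f n),
    forall n x, `|f n x| <= a^-1 * `|x| &
    forall n u, in_c0 u -> f n (T u) = u n].
Proof.
move=> TL a0 aT.
have T0 := linear_on_c00 T TL.
have H n : exists f : X -> R, [/\ linear_on_space f,
    forall x, `|f x| <= a^-1 * `|x| & forall u, in_c0 u -> f (T u) = u n].
  pose G := [set g : X * R | exists2 u, in_c0 u & g = (T u, u n)].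
  have [||||f [lf fp fG]] := hahn_banach (fun x : X => a^-1 * `|x|) G.
  - split=> [x y|t x t0]; last by rewrite normrZ ger0_norm// mulrCA.
    by rewrite -mulrDr ler_pM2l ?invr_gt0// ler_normD.
  - by exists 0; [exact: in_c00|rewrite T0].
  - move=> k _ _ [u u0 ->] [v v0 ->]; exists (k *: u + v) => /=.
      exact: in_c0_lin.
    by rewrite TL.
  - move=> _ [u u0 ->] /=; rewrite ler_pdivlMl//.
    apply: le_trans (aT u u0); rewrite ler_pM2l//.
    exact: le_trans (ler_norm _) (in_c0_le_supnorm u n u0).
  exists f; split=> //.
    move=> x; rewrite ler_norml fp andbT lerNl.
    by have := fp (- x); rewrite -scaleN1r linear_on_spaceZ// mulN1r scaleN1r normrN.
  by move=> u u0; have := fG (T u, u n); apply; exists u.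
have /choice[f fP] := H.
by exists f; split=> n *; have [? ? ?] := fP n; auto.
Qed.

(* Subtracting a weak* cluster point makes the coordinate functionals small
   infinitely often on each finite set, and does not change them on [T c0]. *)
Lemma near_null_coordinate_functionals {R : realType} {X : normedModType R}
    (T : (nat -> R) -> X) (a : R) :
    linear_on_c0 T ->
    0 < a -> (forall u, in_c0 u -> a * supnorm u <= `|T u|) ->
  exists g : nat -> X -> R, [/\ forall n, linear_on_space (g n),
    forall n x, `|g n x| <= 2 / a * `|x|,
    forall n u, in_c0 u -> g n (T u) = u n &
    forall (A : seq X) (e : R), 0 < e ->
      exists n, forall x, x \in A -> `|g n x| <= e].
Proof.
move=> TL a0 aT.
have [f [lf fK fT]] := coordinate_functionals T a TL a0 aT.
have [L [lL LK L0 LA]] := ultra_near0 f a^-1 lf fK.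
exists (fun n x => f n x - L x); split=> //.
- by move=> n k x y; rewrite lf lL; lra.
- move=> n x; apply: le_trans (ler_normB _ _) _.
  by have := fK n x; have := LK x; lra.
- move=> n u u0; rewrite fT// L0 ?subr0//.
  by under eq_fun do rewrite fT//.
Qed.

Definition unit_seq {R : realType} (n : nat) : nat -> R := fun m => (m == n)%:R.

Lemma in_c0_unit_seq {R : realType} (n : nat) : in_c0 (@unit_seq R n).
Proof.
apply: (@cvg_near_cst _ _ (0 : R)); near=> m; rewrite /unit_seq gtn_eqF//.
near: m; exact: nbhs_infty_gt.
Unshelve. all: by end_near. Qed.

(** * Renorming a space that contains [c0] *)

Lemma contains_c0_SQ_renorming {R : realType} (X : normedModType R) :
  contains_c0 X -> exists N : X -> R, equiv_norm N /\ SQ1_lt1_fin N.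
Proof.
move=> [T [TL [a [b [a0 [b0 Tab]]]]]].
have [g [lg gK gT gA]] := near_null_coordinate_functionals T a TL a0
  (fun u u0 => (Tab u u0).1).
pose F (u : nat -> R) (x : X) := `|x - T u|.
(* The quotient seminorm modulo the range of [T] on [c0]. *)
pose d x := inf [set F u x | u in in_c0].
have T0 := linear_on_c00 T TL.
have TZ k u : in_c0 u -> T (k *: u) = k *: T u.
  by move=> u0; have := TL k _ _ u0 in_c00; rewrite T0 !addr0.
have c0Z k (u : nat -> R) : in_c0 u -> in_c0 (k *: u).
  by move=> u0; have := in_c0_lin k _ _ u0 in_c00; rewrite addr0.
have lbF x : has_lbound [set F u x | u in in_c0].
  by exists 0 => _ [u u0 <-]; exact: normr_ge0.
have dF x u : in_c0 u -> d x <= F u x.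
  by move=> u0; apply: ge_inf => //; exists u.
have le_d c x : (forall u, in_c0 u -> c <= F u x) -> c <= d x.
  move=> cF; apply: lb_le_inf; first by exists (F 0 x); exists 0 => //; exact: in_c00.
  by move=> _ [u u0 <-]; exact: cF.
have d_ge0 x : 0 <= d x by apply/le_d => u _; exact: normr_ge0.
have [dD dZ] : sublinear d.
  apply: sublinear_inf => //; first by exists 0; exact: in_c00.
  - move=> u v x y u0 v0; exists (1 *: u + v); first exact: in_c0_lin.
    by rewrite /F TL// scale1r opprD addrACA; exact: ler_normD.
  - move=> u t x u0 t0; exists (t *: u); first exact: c0Z.
    by rewrite /F TZ// -scalerBr normrZ ger0_norm.
have dN x : d (- x) <= d x.
  apply/le_d => u u0; apply: le_trans (dF _ (- 1 *: u) (c0Z _ _ u0)) _.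
  by rewrite /F TZ// scaleN1r -opprD normrN.
have dT x u : in_c0 u -> d (x + T u) <= d x.
  move=> u0; apply/le_d => v v0.
  apply: le_trans (dF _ (1 *: u + v) (in_c0_lin _ _ _ u0 v0)) _.
  by rewrite /F TL// scale1r opprD addrA addrK.
pose q x := supnorm (g^~ x).
(* The uniform bound [gK] makes the supremum [q x] finite. *)
have gq n x : `|g n x| <= q x by exact: (@le_supnorm _ (g^~ x) _ _ (gK^~ x)).
have q_le c x : (forall n, `|g n x| <= c) -> q x <= c by exact: supnorm_le.
pose N x := Num.max (q x) (d x).
have N_le c x : q x <= c -> d x <= c -> N x <= c by rewrite /N ge_max => -> ->.
have qN x : q x <= N x by rewrite /N le_max lexx.
have dN' x : d x <= N x by rewrite /N le_max lexx orbT.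
pose K := 2 / a.
have K0 : 0 < K by rewrite divr_gt0.
have NZ k x : N (k *: x) <= `|k| * N x.
  apply: N_le.
    apply: q_le => n; rewrite linear_on_spaceZ// normrM ler_wpM2l//.
    exact: le_trans (gq _ _) (qN _).
  apply: le_trans (ler_wpM2l (normr_ge0 k) (dN' x)).
  have [k0|k0] := leP 0 k; first by rewrite ger0_norm//; exact: dZ.
  rewrite ltr0_norm// -[k in d (k *: _)]opprK scaleNr.
  by apply: le_trans (dN _) _; apply: dZ; rewrite oppr_ge0 ltW.
have N_lower x : `|x| <= (1 + b * K + b) * N x.
  (* Split [x] as [(x - T u) + T u]. The coordinates of [u] are [g n (T u) = g n x - g n (x - T u)],
     so [q x] and the norm of [x - T u] control [T u]. The infimum over [u] then replaces [F u x] by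
     [d x]. *)
  have H u : in_c0 u -> `|x| <= (1 + b * K) * F u x + b * N x.
    move=> u0; have xTu : `|x| <= F u x + `|T u|.
      by rewrite -[X in `|X|](subrK (T u)); exact: ler_normD.
    have Tub : `|T u| <= b * (K * F u x + N x).
      apply: le_trans (Tab u u0).2 _; rewrite ler_pM2l//.
      apply: supnorm_le => n; rewrite -(gT n u u0).
      have -> : T u = - 1 *: (x - T u) + x by rewrite scaleN1r opprB subrK.
      rewrite lg mulN1r; apply: le_trans (ler_normD _ _) _; rewrite normrN.
      by apply: lerD; [exact: gK|exact: le_trans (gq _ _) (qN _)].
    lra.
  have dK : 0 < 1 + b * K by rewrite addr_gt0// mulr_gt0.
  have H2 : (`|x| - b * N x) / (1 + b * K) <= d x.
    by apply/le_d => u u0; rewrite ler_pdivrMr// mulrC; have := H u u0; lra.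
  have := le_trans H2 (dN' x); rewrite ler_pdivrMr//; lra.
have N_upper x : N x <= (K + 1) * `|x|.
  have x0 := normr_ge0 x.
  apply: N_le.
    apply: q_le => n; apply: le_trans (gK n x) _.
    by rewrite ler_wpM2r// lerDl.
  apply: le_trans (dF x 0 in_c00) _; rewrite /F T0 subr0.
  by rewrite ler_peMl// lerDr ltW.
have Kc : 0 < 1 + b * K + b by rewrite !addr_gt0// mulr_gt0.
have N_ge0 x : 0 <= N x by exact: le_trans (d_ge0 x) (dN' x).
have eN : equiv_norm N.
  split; last first.
    exists (1 + b * K + b)^-1, (K + 1); rewrite invr_gt0; split=> //.
    by split; [rewrite addr_gt0|move=> x; rewrite ler_pdivrMl].
  split=> //; split.
    move=> x Nx0; have := N_lower x; rewrite Nx0 mulr0 normr_le0.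
    by move=> /eqP.
  split=> [k x|x y].
    apply/eqP; rewrite eq_le NZ/=.
    have [->|k0] := eqVneq k 0; first by rewrite normr0 mul0r.
    have := NZ k^-1 (k *: x); rewrite scalerA mulVf// scale1r normfV.
    by rewrite ler_pdivlMl// normr_gt0.
  apply: N_le; last by apply: le_trans (dD _ _) _; exact: lerD.
  apply: q_le => n; rewrite linear_on_spaceD//; apply: le_trans (ler_normD _ _) _.
  by apply: lerD; exact: le_trans (gq _ _) (qN _).
exists N; split=> // s s0 s1 A A1.
(* The tolerance [1 - s] leaves room for a change of size [s] in the coordinate [n]. *)
have [n nA] := gA A (1 - s) ltac:(lra).
have gE m : g m (T (unit_seq n)) = (m == n)%:R.
  by rewrite gT//; exact: in_c0_unit_seq.
(* Moving along [T (unit_seq n)] does not increase [d] and changes only the functional [g n], whose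
   value stays within [(1 - s) + s]. *)
have Nstep x t : x \in A -> `|t| <= s -> N (x + t *: T (unit_seq n)) <= 1.
  move=> xA ts; have Nx := A1 x xA; apply: N_le; last first.
    rewrite -TZ; last exact: in_c0_unit_seq.
    rewrite -Nx; apply: le_trans (dN' x); apply: dT.
    by apply: c0Z; exact: in_c0_unit_seq.
  apply: q_le => m; rewrite linear_on_spaceD// linear_on_spaceZ// gE.
  have [->|_] := eqVneq m n; last first.
    by rewrite mulr0 addr0 -Nx; exact: le_trans (gq _ _) (qN _).
  rewrite mulr1; apply: le_trans (ler_normD _ _) _.
  by have := nA x xA; lra.
exists (T (unit_seq n)); split.
  apply/eqP; rewrite eq_le; apply/andP; split.
    apply: N_le.
      by apply: q_le => m; rewrite gE; case: eqP; rewrite ?normr0 ?normr1 ?ler01.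
    apply: le_trans (ler01); rewrite -[T _]add0r.
    apply: le_trans (dT _ _ (in_c0_unit_seq n)) _.
    by apply: le_trans (dF _ 0 in_c00) _; rewrite /F T0 subr0 normr0.
  apply: le_trans (qN _); apply: le_trans (gq n _); by rewrite gE eqxx normr1.
move=> x xA; rewrite -scaleNr; split; apply: Nstep => //.
  by rewrite gtr0_norm.
by rewrite normrN gtr0_norm.
Qed.

(** * A copy of [c0] from an almost square norm *)

Lemma is_norm_opp {R : realType} {V : lmodType R} (N : V -> R) (x : V) :
  is_norm N -> N (- x) = N x.
Proof. by move=> [_ [_ [NZ _]]]; rewrite -scaleN1r NZ normrN1 mul1r. Qed.

(** [z + t *: w] is the convex combination of [z + w] and [z - w] with weights [(1 + t) / 2] and
    [(1 - t) / 2]. *)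
Lemma is_norm_segment {R : realType} {V : lmodType R} (N : V -> R) (z w : V)
    (t c : R) :
  is_norm N -> `|t| <= 1 -> N (z + w) <= c -> N (z - w) <= c -> N (z + t *: w) <= c.
Proof.
move=> [_ [_ [NZ ND]]]; rewrite ler_norml => /andP[t1 t2] h1 h2.
have -> : z + t *: w = ((1 + t) / 2) *: (z + w) + ((1 - t) / 2) *: (z - w).
  rewrite !scalerDr !scalerN addrACA -scalerDl -scalerBl.
  have -> : (1 + t) / 2 + (1 - t) / 2 = 1 by field.
  have -> : (1 + t) / 2 - (1 - t) / 2 = t by field.
  by rewrite scale1r.
apply: le_trans (ND _ _) _; rewrite !NZ !ger0_norm; [nra|lra|lra].
Qed.

(** The inductive construction meets vectors inside the unit ball, not only on the sphere. A nonzero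
    one lies on the segment between its normalization and the opposite vector, so the sphere case
    and convexity suffice; at zero, [N (s *: y) = s <= 1]. *)
Lemma SQ1_fin_ball {R : realType} {V : lmodType R} (N : V -> R) (s : R) (A : seq V) :
    is_norm N -> SQ1_fin N s -> 0 < s -> s <= 1 ->
    (forall x, x \in A -> N x <= 1) ->
  exists y, N y = 1 /\ forall x, x \in A -> N (x + s *: y) <= 1 /\ N (x - s *: y) <= 1.
Proof.
move=> nN SQ s0 s1 A1; have [N0 [Neq0 [NZ ND]]] := nN.
have [|y [Ny Ay]] := SQ [seq (N x)^-1 *: x | x <- A & N x != 0].
  move=> w /mapP[x] + ->; rewrite mem_filter => /andP[Nx _].
  by rewrite NZ normfV ger0_norm// mulVf.
exists y; split=> // x xA.
suff : N (s *: y + x) <= 1 /\ N (s *: y - x) <= 1.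
  by rewrite addrC -(is_norm_opp N (x - _) nN) opprB.
have [Nx0|Nx0] := eqVneq (N x) 0.
  by rewrite (Neq0 _ Nx0) subr0 addr0 NZ Ny mulr1 ger0_norm// ltW.
have [|h1 h2] := Ay ((N x)^-1 *: x).
  by apply/mapP; exists x => //; rewrite mem_filter Nx0.
rewrite addrC in h1; rewrite -(is_norm_opp N _ nN) opprB in h2.
have xE : x = N x *: ((N x)^-1 *: x) by rewrite scalerA mulfV// scale1r.
have Nx1 : `|N x| <= 1 by rewrite ger0_norm// A1.
split; first by rewrite xE; exact: is_norm_segment.
by rewrite xE -scaleNr; apply: is_norm_segment; rewrite ?normrN.
Qed.

(* [L n] lists the sums of [s *: y i], [i < n], with all choices of signs; a sum
   with coefficients in [-1, 1] is a convex combination of these. *)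
Lemma SQ1_fin_sequence {R : realType} {V : lmodType R} (N : V -> R) (s : R) :
    is_norm N -> SQ1_fin N s -> 0 < s -> s <= 1 ->
  exists y : nat -> V, (forall n, N (y n) = 1) /\
    forall n (c : nat -> R), (forall i, `|c i| <= 1) ->
      N (\sum_(i < n) c i *: (s *: y i)) <= 1.
Proof.
move=> nN SQ s0 s1.
have /choice[Y YP] (A : seq V) : exists y, (forall x, x \in A -> N x <= 1) ->
    N y = 1 /\ forall x, x \in A -> N (x + s *: y) <= 1 /\ N (x - s *: y) <= 1.
  (* The value 0 on lists that leave the unit ball is a default making [Y] total. *)
  have [A1|nA1] := pselect (forall x, x \in A -> N x <= 1); last by exists 0.
  by have [y yP] := SQ1_fin_ball N s A nN SQ s0 s1 A1; exists y.
pose next L := [seq x + s *: Y L | x <- L] ++ [seq x - s *: Y L | x <- L].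
pose L n := iter n next [:: 0].
have L1 n x : x \in L n -> N x <= 1.
  elim: n x => [|n IH] x.
    have [_ [_ [NZ _]]] := nN.
    by rewrite inE => /eqP ->; rewrite -(scale0r 0) NZ normr0 mul0r.
  have [_ YL] := YP (L n) IH.
  by rewrite /= mem_cat => /orP[] /mapP[z /YL[? ?] ->].
exists (Y \o L); split=> [n|n c c1]; first by have [] := YP (L n) (L1 n).
(* The offset [z] absorbs the last term. For [x] in [L n], the sum of [z + x] and that term lies
   between the points [z + (x + s *: Y (L n))] and [z + (x - s *: Y (L n))], both covered by
   [L n.+1]. *)
suff H z : (forall x, x \in L n -> N (z + x) <= 1) ->
    N (z + \sum_(i < n) c i *: (s *: Y (L i))) <= 1.
  by have := H 0; rewrite add0r; apply => x; rewrite add0r; exact: L1.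
elim: n z => [|n IH] z zL; first by rewrite big_ord0; apply: zL; rewrite inE.
rewrite big_ord_recr/= [X in z + X]addrC addrA; apply: IH => x xL.
rewrite addrAC; apply: is_norm_segment => //; rewrite -addrA; apply: zL.
  by rewrite /= mem_cat; apply/orP; left; apply/mapP; exists x.
by rewrite /= mem_cat; apply/orP; right; apply/mapP; exists x.
Qed.

Lemma equiv_norm_cvg {R : realType} {X : normedModType R} (N : X -> R)
    (u : nat -> X) (l : X) :
  equiv_norm N -> u n @[n --> \oo] --> l -> N (u n) @[n --> \oo] --> N l.
Proof.
move=> [nN [c [C [_ [C0 NC]]]]] ul; have [_ [_ [_ ND]]] := nN.
apply/cvgrPdist_le => e e0.
have /cvgrPdist_le/(_ (e / C) (divr_gt0 e0 C0)) := ul.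
apply: filterS => n; rewrite ler_pdivlMr// mulrC => h.
have [_ h1] := NC (l - u n).
have := ND (l - u n) (u n); have := ND (u n - l) l.
rewrite !subrK -(is_norm_opp N (u n - l) nN) opprB ler_norml => *.
by apply/andP; split; lra.
Qed.

Lemma SQ1_fin_contains_c0 {R : realType} (X : completeNormedModType R)
    (N : X -> R) (s : R) :
  equiv_norm N -> 1 / 2 < s -> s <= 1 -> SQ1_fin N s -> contains_c0 X.
Proof.
move=> eN s2 s1 SQ; have [nN [c [C [c0 [C0 cNC]]]]] := eN.
have [N0 [Neq0 [NZ ND]]] := nN.
have s0 : 0 < s by lra.
have [y [Ny Ny1]] := SQ1_fin_sequence N s nN SQ s0 s1.
(* Rescaling by [M / s] reduces this to coefficients in [[-1, 1]]; the case [M = 0] is separate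
   because of the division. *)
have sumM n (u : nat -> R) M : 0 <= M -> (forall i, `|u i| <= M) ->
    N (\sum_(i < n) u i *: y i) <= M / s.
  move=> M0 uM; have [M00|M00] := eqVneq M 0.
    rewrite big1 => [|i _]; last first.
      by have := uM i; rewrite M00 normr_le0 => /eqP ->; rewrite scale0r.
    by rewrite -(scale0r 0) NZ normr0 mul0r divr_ge0// ltW.
  have Mgt0 : 0 < M by rewrite lt_neqAle eq_sym M00.
  have -> : \sum_(i < n) u i *: y i =
      (M / s) *: \sum_(i < n) (u i / M) *: (s *: y i).
    rewrite scaler_sumr; apply: eq_bigr => i _; rewrite !scalerA.
    by congr (_ *: _); field; rewrite M00 gt_eqF.
  have Ms : 0 <= M / s by rewrite divr_ge0// ltW.
  rewrite NZ ger0_norm// ler_piMr//.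
  apply: (Ny1 n (fun i => u i / M)) => i; rewrite normrM normfV [`|M|]ger0_norm//.
  by rewrite ler_pdivrMr// mul1r.
pose S (u : nat -> R) : nat -> X := series (fun i => u i *: y i).
have SE u n : S u n = \sum_(i < n) u i *: y i by rewrite /S /series/= big_mkord.
have cS u : in_c0 u -> cvgn (S u).
  move=> u0; apply/cauchy_cvgP/cauchy_seriesP => e e0.
  (* With this bound on the coefficients, [sumM] gives a block of [N]-norm at most [c * e / 2],
     hence of norm at most [e / 2 < e]. Blocks are padded with zeros to become initial sums. *)
  have es : 0 < c * e * s / 2 by rewrite !mulr_gt0.
  have /cvgrPdist_le/(_ _ es) [m _ um] := u0.
  exists ([set n | (m <= n)%N], [set n | (m <= n)%N]).
    by split; exists m.
  move=> [n1 n2] [/= mn1 mn2].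
  rewrite (big_nat_widenl _ 0%N)// big_mkcond/= big_mkord.
  have -> : \sum_(i < n2) (if (n1 <= i)%N then u i *: y i else 0) =
      \sum_(i < n2) (if (n1 <= i)%N then u i else 0) *: y i.
    by apply: eq_bigr => i _; case: ifP => // _; rewrite scale0r.
  have := sumM n2 (fun i => if (n1 <= i)%N then u i else 0) _ (ltW es).
  set x := \sum_(i < n2) _ => h.
  have {}h : N x <= c * e * s / 2 / s.
    apply: h => i; case: ifP => [n1i|_]; last by rewrite normr0 ltW.
    by have := um i (leq_trans mn1 n1i); rewrite sub0r normrN.
  have {}h : c * `|x| <= c * (e / 2).
    apply: le_trans (cNC x).1 _; apply: le_trans h _.
    by rewrite le_eqVlt; apply/orP; left; apply/eqP; field; rewrite gt_eqF.
  by rewrite ler_pM2l// in h; lra.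
pose T u := limn (S u).
have ST u : in_c0 u -> S u n @[n --> \oo] --> T u by exact: cS.
have NST u : in_c0 u -> N (S u n) @[n --> \oo] --> N (T u).
  by move=> u0; apply: equiv_norm_cvg => //; exact: ST.
have sup0 (u : nat -> R) : in_c0 u -> 0 <= supnorm u.
  by move=> u0; apply: le_trans (in_c0_le_supnorm u 0 u0).
have T_upper u : in_c0 u -> N (T u) <= supnorm u / s.
  move=> u0; rewrite -(cvg_lim _ (NST u u0))//.
  apply: limr_le; first by apply/cvg_ex; eexists; exact: NST.
  apply: nearW => n; rewrite SE; apply: sumM; first exact: sup0.
  by move=> i; exact: in_c0_le_supnorm.
(* Changing the sign of one coefficient moves the sum by [2 |u i|]. *)
have T_lower u i : in_c0 u -> 2 * `|u i| - supnorm u / s <= N (T u).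
  move=> u0; rewrite -(cvg_lim _ (NST u u0))//.
  apply: limr_ge; first by apply/cvg_ex; eexists; exact: NST.
  exists i.+1 => // n /= iltn; rewrite SE.
  pose v j := if j == i then - u i else u j.
  have Nv : N (\sum_(j < n) v j *: y j) <= supnorm u / s.
    apply: sumM; first exact: sup0.
    by move=> j; rewrite /v; case: eqP => _; rewrite ?normrN in_c0_le_supnorm.
  have uv : (2 * u i) *: y i =
      \sum_(j < n) u j *: y j - \sum_(j < n) v j *: y j.
    rewrite -sumrB (bigD1 (Ordinal iltn))//= [X in _ + X]big1 ?addr0.
      by rewrite /v eqxx scaleNr opprK -scalerDl mulr2n mulrDl !mul1r.
    by move=> j ji; rewrite /v -val_eqE/= in ji *; rewrite (negbTE ji) subrr.
  have := ND (\sum_(j < n) u j *: y j) (- \sum_(j < n) v j *: y j).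
  by rewrite -uv NZ Ny normrM normr_nat is_norm_opp//; lra.
exists T; split.
  move=> k u v u0 v0; apply: (@cvg_lim X) => //.
  have -> : S (k *: u + v) = fun n => k *: S u n + S v n.
    apply/funext => n; rewrite !SE scaler_sumr -big_split/=.
    by apply: eq_bigr => i _; rewrite scalerDl scalerA.
  by apply: cvgD; [apply: cvgZr; exact: ST|exact: ST].
(* Here [1 / 2 < s] makes the lower constant [2 - s^-1] positive. Dividing by [C] and [c] transfers
   the bounds from [N] to the original norm. *)
have s_inv : s^-1 < 2 by rewrite -div1r ltr_pdivrMr//; lra.
exists ((2 - s^-1) / C), (s^-1 / c); split; first by rewrite divr_gt0// subr_gt0.
split; first by rewrite divr_gt0 ?invr_gt0.
move=> u u0; have [Tc TC] := cNC (T u); split.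
  rewrite mulrAC ler_pdivrMr// mulrC [_ * C]mulrC.
  apply: le_trans TC.
  (* The supremum over [i] in [T_lower] gives [(2 - s^-1) * supnorm u <= N (T u)]. *)
  have : supnorm u <= (N (T u) + supnorm u / s) / 2.
    by apply: supnorm_le => i; have := T_lower u i u0; lra.
  lra.
rewrite mulrAC ler_pdivlMr// mulrC; apply: le_trans Tc _.
by rewrite mulrC; exact: T_upper.
Qed.

Theorem theorem6p8 (R : realType) (X : completeNormedModType R) :
  contains_c0 X <-> exists N : X -> R, equiv_norm N /\ SQ1_lt1_fin N.
Proof.
split; first exact: contains_c0_SQ_renorming.
(* Any value strictly between 1/2 and 1 would serve in place of 3/4. *)
move=> [N [eN SQ]]; apply: (SQ1_fin_contains_c0 X N (3 / 4)) => //; try lra.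
by apply: SQ; lra.
Qed.
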